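(* If $L$ is a countable locally finite group, then $L$ is isomorphic to a subgroup of $\mathrm{Comm}(\mathbb{F})$, the abstract commensurator of a finite-rank nonabelian free group; that is, there is an injective group homomorphism $L \to \mathrm{Comm}(\mathbb{F})$.
   Context: A group is locally finite if every finitely generated subgroup is finite. For a group $G$, the abstract commensurator $\mathrm{Comm}(G)$ is the set of isomorphisms $\phi : H \to K$ between finite-index subgroups $H, K \leq G$, modulo the equivalence relation identifying two such isomorphisms when they agree on some finite-index subgroup of $G$ contained in both domains; it is a group under composition (defined after restricting to a suitable finite-index subgroup). Let $\mathbb{F}_k$ be the free group of rank $k$. For all finite $k \geq 2$ the groups $\mathbb{F}_k$ and $\mathbb{F}_2$ have isomorphic finite-index subgroups, so $\mathrm{Comm}(\mathbb{F}_k) \cong \mathrm{Comm}(\mathbb{F}_2)$, and this group is denoted $\mathrm{Comm}(\mathbb{F})$. *)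

(* Defs.v *)
From HB Require Import structures.
From mathcomp Require Import all_boot.
From mathcomp Require Import boolp classical_sets functions cardinality.

Set Implicit Arguments.
Unset Strict Implicit.
Unset Printing Implicit Defensive.

Local Open Scope classical_set_scope.
Local Open Scope quotient_scope.
Local Open Scope group_scope.

Section Subgroups.
Variable G : groupType.
Implicit Types (A H K : set G) (x y : G).

Definition subgroup H := H 1 /\ forall x y, H x -> H y -> H (x / y).

Definition generated A : set G := smallest subgroup A.

Definition finitely_generated H := exists2 A, finite_set A & H = generated A.

Definition left_cosets H : set (set G) :=
  [set [set x * h | h in H] | x in [set: G]].

Definition finite_index H := finite_set (left_cosets H).

Lemma subgroupV H x : subgroup H -> H x -> H x^-1.
Proof. by move=> [H1 HF] Hx; rewrite -[x^-1]mul1g; apply: HF. Qed.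

Lemma subgroupM H x y : subgroup H -> H x -> H y -> H (x * y).
Proof.
move=> sH Hx Hy; rewrite -[y]invgK; case: (sH) => _; apply => //.
exact: subgroupV.
Qed.

Lemma subgroupT : subgroup [set: G]. Proof. by []. Qed.

Lemma finite_indexP H : subgroup H ->
  finite_index H <->
  exists (T : Type) (c : G -> T),
    finite_set (range c) /\ forall x y, c x = c y -> H (x^-1 * y).
Proof.
move=> sH; split=> [fH|[T [c [fc cP]]]].
  exists (set G), (fun x => [set x * h | h in H]); split=> // x y e.
  have : [set x * h | h in H] y by rewrite e; exists 1; [case: sH|rewrite mulg1].
  by case=> h Hh <-; rewrite mulKg.
pose r t : G := xget 1 [set x | c x = t].
apply: (sub_finite_set _
  (finite_image (fun t => [set r t * h | h in H]) fc)) => _ [x _ <-].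
exists (c x) => //; have rx : c (r (c x)) = c x.
  by rewrite /r; case: xgetP => [y _ //|/(_ x) []].
have Hrx := cP _ _ rx; have Hxr := subgroupV sH Hrx.
rewrite invgM invgK in Hxr.
apply/seteqP; split=> _ [h Hh <-].
  exists (x^-1 * r (c x) * h); first exact: subgroupM.
  by rewrite !mulgA mulgV mul1g.
exists ((r (c x))^-1 * x * h); first exact: subgroupM.
by rewrite !mulgA mulgV mul1g.
Qed.

Lemma finite_indexT : finite_index [set: G].
Proof.
by apply/(finite_indexP subgroupT); exists unit, (fun=> tt).
Qed.

Lemma subgroupI H K : subgroup H -> subgroup K -> subgroup (H `&` K).
Proof.
move=> [H1 HF] [K1 KF]; split=> // x y [Hx Kx] [Hy Ky].
by split; [apply: HF | apply: KF].
Qed.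

Section Preimage.
Variables (H K : set G) (f : G -> G).
Hypotheses (sH : subgroup H) (sK : subgroup K).
Hypothesis fM : {in H &, {morph f : x y / x * y}}.

Let fM' x y : H x -> H y -> f (x * y) = f x * f y.
Proof. by move=> Hx Hy; apply: fM; rewrite inE. Qed.

Lemma partial_morph1 : f 1 = 1.
Proof.
have [H1 _] := sH.
by apply: (mulgI (f 1)); rewrite -fM' // !mulg1.
Qed.

Lemma partial_morphV x : H x -> f x^-1 = (f x)^-1.
Proof.
move=> Hx; have Hx' := subgroupV sH Hx; apply: (mulgI (f x)).
by rewrite -fM' // !mulgV partial_morph1.
Qed.

Lemma subgroup_preim : subgroup (H `&` f @^-1` K).
Proof.
have [H1 HF] := sH; have [K1 KF] := sK.
split=> [|x y [Hx Kx] [Hy Ky]]; first by split=> //=; rewrite partial_morph1.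
split; first exact: HF.
by rewrite /= fM' ?partial_morphV //; [apply: KF | apply: subgroupV].
Qed.

Lemma finite_index_preim :
  finite_index H -> finite_index K -> finite_index (H `&` f @^-1` K).
Proof.
move=> /(finite_indexP sH)[T [c [fc cP]]] /(finite_indexP sK)[U [d [fd dP]]].
apply/(finite_indexP subgroup_preim).
pose r t : G := xget 1 [set x | c x = t].
exists (T * U)%type, (fun x => (c x, d (f ((r (c x))^-1 * x)))); split.
  apply: (sub_finite_set _ (finite_setX fc fd)) => _ [x _ <-].
  by split; [exists x | exists (f ((r (c x))^-1 * x))].
move=> x y [cxy]; rewrite -cxy; set z := r (c x) => dxy.
have cz : c z = c x by rewrite /z /r; case: xgetP => [w _ //|/(_ x) []].
have Hx : H (z^-1 * x) by apply: cP.
have Hy : H (z^-1 * y) by apply: cP; rewrite cz.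
have Hx' := subgroupV sH Hx.
have <- : (z^-1 * x)^-1 * (z^-1 * y) = x^-1 * y.
  by rewrite invgM invgK mulgA mulgK.
split; first exact: subgroupM.
by rewrite /= fM' // partial_morphV //; apply: dP.
Qed.
End Preimage.

Lemma finite_indexI H K : subgroup H -> subgroup K ->
  finite_index H -> finite_index K -> finite_index (H `&` K).
Proof.
move=> sH sK fH fK.
by apply: (@finite_index_preim H K id).
Qed.

End Subgroups.

Definition locally_finite (G : groupType) :=
  forall H : set G, subgroup H -> finitely_generated H -> finite_set H.

(* Isomorphisms between finite-index subgroups of G. The map is represented
   by a total function on G; its values outside fiso_dom are junk, which
   fiso_equiv ignores. *)
Record fiso (G : groupType) := FIso {
  fiso_dom : set G;
  fiso_cod : set G;
  fiso_fun :> G -> G;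
  fiso_dom_subgroup : subgroup fiso_dom;
  fiso_cod_subgroup : subgroup fiso_cod;
  fiso_dom_index : finite_index fiso_dom;
  fiso_cod_index : finite_index fiso_cod;
  fiso_morph : {in fiso_dom &, {morph fiso_fun : x y / x * y}};
  fiso_bij : set_bij fiso_dom fiso_cod fiso_fun }.

HB.instance Definition _ (G : groupType) := gen_eqMixin (fiso G).
HB.instance Definition _ (G : groupType) := gen_choiceMixin (fiso G).

Section Commensurator.
Variable G : groupType.
Implicit Types p q r : fiso G.

Lemma fisoM p x y : fiso_dom p x -> fiso_dom p y -> p (x * y) = p x * p y.
Proof. by move=> px py; apply: fiso_morph; rewrite inE. Qed.

Lemma fiso_codP p x : fiso_dom p x -> fiso_cod p (p x).
Proof. by case: (fiso_bij p) => + _ _; apply. Qed.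

Lemma fiso_inj p x y : fiso_dom p x -> fiso_dom p y -> p x = p y -> x = y.
Proof. by case: (fiso_bij p) => _ inj _ px py; apply: inj; rewrite inE. Qed.

Definition fiso_equiv p q := exists K : set G,
  [/\ subgroup K, finite_index K, K `<=` fiso_dom p `&` fiso_dom q
    & {in K, p =1 q}].

Lemma fiso_equiv_refl p : fiso_equiv p p.
Proof.
exists (fiso_dom p); split=> //; first exact: fiso_dom_subgroup.
exact: fiso_dom_index.
Qed.

Lemma fiso_equiv_sym p q : fiso_equiv p q -> fiso_equiv q p.
Proof.
move=> [K [sK fK Kpq e]]; exists K; split=> //; first by rewrite setIC.
by move=> x Kx; rewrite e.
Qed.

Lemma fiso_equiv_trans p q r :
  fiso_equiv p q -> fiso_equiv q r -> fiso_equiv p r.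
Proof.
move=> [K [sK fK Kpq eK]] [L [sL fL Lqr eL]]; exists (K `&` L); split.
- exact: subgroupI.
- exact: finite_indexI.
- by move=> x [/Kpq[? _] /Lqr[]].
- by move=> x /set_mem[Kx Lx]; rewrite eK ?eL ?inE.
Qed.

Definition fiso_eqb p q : bool := `[< fiso_equiv p q >].

Lemma fiso_eqb_refl : reflexive fiso_eqb.
Proof. by move=> p; apply/asboolP/fiso_equiv_refl. Qed.

Lemma fiso_eqb_sym : symmetric fiso_eqb.
Proof. by move=> p q; apply/asboolP/asboolP; apply: fiso_equiv_sym. Qed.

Lemma fiso_eqb_trans : transitive fiso_eqb.
Proof.
by move=> q p r /asboolP pq /asboolP qr; apply/asboolP/(fiso_equiv_trans pq).
Qed.

Canonical fiso_equiv_rel :=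
  EquivRel fiso_eqb fiso_eqb_refl fiso_eqb_sym fiso_eqb_trans.

Lemma id_fiso_bij : set_bij [set: G] [set: G] id.
Proof. by split=> // x _; exists x. Qed.

Definition id_fiso : fiso G :=
  @FIso G setT setT id (@subgroupT G) (@subgroupT G) (@finite_indexT G)
    (@finite_indexT G) (fun _ _ _ _ => erefl) id_fiso_bij.

Definition inv_fun p (y : G) : G := xget 1 [set x | fiso_dom p x /\ p x = y].

Lemma inv_funP p y :
  fiso_cod p y -> fiso_dom p (inv_fun p y) /\ p (inv_fun p y) = y.
Proof.
case: (fiso_bij p) => _ _ surj /surj[x px <-].
by rewrite /inv_fun; case: xgetP => [z _ //|/(_ x)[]].
Qed.

Lemma inv_funK p x : fiso_dom p x -> inv_fun p (p x) = x.
Proof.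
by move=> px; have [d e] := inv_funP (fiso_codP px); apply: (fiso_inj d).
Qed.

Lemma inv_fiso_morph p :
  {in fiso_cod p &, {morph inv_fun p : x y / x * y}}.
Proof.
move=> x y /set_mem /inv_funP[dx ex] /set_mem /inv_funP[dy ey].
rewrite -{1}ex -{1}ey -fisoM // inv_funK //.
exact: (subgroupM (fiso_dom_subgroup p)).
Qed.

Lemma inv_fiso_bij p : set_bij (fiso_cod p) (fiso_dom p) (inv_fun p).
Proof.
split=> [y /inv_funP[] //|x y /set_mem /inv_funP[_ ex]
  /set_mem /inv_funP[_ ey] e|x px]; first by rewrite -ex -ey e.
by exists (p x); [apply: fiso_codP | apply: inv_funK].
Qed.

Definition inv_fiso p : fiso G :=
  @FIso G (fiso_cod p) (fiso_dom p) (inv_fun p)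
    (fiso_cod_subgroup p) (fiso_dom_subgroup p)
    (fiso_cod_index p) (fiso_dom_index p) (@inv_fiso_morph p) (inv_fiso_bij p).

Definition comp_dom p q := fiso_dom q `&` q @^-1` fiso_dom p.
Definition comp_cod p q := fiso_cod p `&` inv_fun p @^-1` fiso_cod q.

Lemma comp_morph p q : {in comp_dom p q &, {morph p \o q : x y / x * y}}.
Proof. by move=> x y /set_mem[? ?] /set_mem[? ?] /=; rewrite !fisoM. Qed.

Lemma comp_bij p q : set_bij (comp_dom p q) (comp_cod p q) (p \o q).
Proof.
split=> [x [qx px]|x y /set_mem[qx px] /set_mem[qy py] /= e|z [pz qz]].
- by split=> /=; [|rewrite inv_funK //]; apply: fiso_codP.
- exact/(fiso_inj qx qy)/(fiso_inj px py).
have [pd pe] := inv_funP pz; have [qd qe] := inv_funP qz.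
by exists (inv_fun q (inv_fun p z)); rewrite /comp_dom /= ?qe.
Qed.

(* p after q, on the largest subgroup where this makes sense. *)
Definition comp_fiso p q : fiso G :=
  @FIso G (comp_dom p q) (comp_cod p q) (p \o q)
    (subgroup_preim (fiso_dom_subgroup q) (fiso_dom_subgroup p)
      (@fiso_morph _ q))
    (subgroup_preim (fiso_cod_subgroup p) (fiso_cod_subgroup q)
      (@inv_fiso_morph p))
    (finite_index_preim (fiso_dom_subgroup q) (fiso_dom_subgroup p)
      (@fiso_morph _ q) (fiso_dom_index q) (fiso_dom_index p))
    (finite_index_preim (fiso_cod_subgroup p) (fiso_cod_subgroup q)
      (@inv_fiso_morph p) (fiso_cod_index p) (fiso_cod_index q))
    (@comp_morph p q) (comp_bij p q).

Lemma fiso_equiv_dom p q :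
  (forall x, fiso_dom p x -> fiso_dom q x /\ p x = q x) -> fiso_equiv p q.
Proof.
move=> pq; exists (fiso_dom p); split.
- exact: fiso_dom_subgroup.
- exact: fiso_dom_index.
- by move=> x px; split=> //; case: (pq x px).
- by move=> x /set_mem /pq[].
Qed.

Lemma comp_fiso_equiv p p' q q' :
  fiso_equiv p p' -> fiso_equiv q q' ->
  fiso_equiv (comp_fiso p q) (comp_fiso p' q').
Proof.
move=> [K [sK fK Kp eK]] [L [sL fL Lq eL]].
have qM : {in L &, {morph q : x y / x * y}}.
  move=> x y /set_mem /Lq[qx _] /set_mem /Lq[qy _]; exact: fisoM.
exists (L `&` q @^-1` K); split.
- exact: subgroup_preim.
- exact: finite_index_preim.
- move=> x [Lx Kx]; have [qx q'x] := Lq _ Lx; have [px p'x] := Kp _ Kx.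
  by split; split=> //=; rewrite -eL ?inE.
- by move=> x /set_mem[Lx Kx] /=; rewrite -eL ?eK ?inE.
Qed.

Lemma inv_fiso_equiv p p' :
  fiso_equiv p p' -> fiso_equiv (inv_fiso p) (inv_fiso p').
Proof.
move=> [K [sK fK Kp eK]].
have pP y : (fiso_cod p `&` inv_fun p @^-1` K) y ->
    fiso_cod p' y /\ inv_fun p y = inv_fun p' y.
  move=> [/inv_funP[d e] Ky]; have [_ d'] := Kp _ Ky.
  have e' : p' (inv_fun p y) = y by rewrite -eK ?inE.
  by rewrite -[in fiso_cod _ _]e' -[in RHS]e' inv_funK //; split=> //;
    apply: fiso_codP.
exists (fiso_cod p `&` inv_fun p @^-1` K); split.
- apply: subgroup_preim => //; first exact: fiso_cod_subgroup.
  exact: inv_fiso_morph.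
- apply: finite_index_preim => //; first exact: fiso_cod_subgroup.
    exact: inv_fiso_morph.
  exact: fiso_cod_index.
- by move=> y Ky; split; [case: Ky | case: (pP y Ky)].
- by move=> y /set_mem /pP[].
Qed.

(* The abstract commensurator of G. *)
Definition commensurator := {eq_quot fiso_equiv_rel}.

HB.instance Definition _ := Choice.on commensurator.
HB.instance Definition _ := EqQuotient.on commensurator.

Lemma comm_eqP p q : \pi_commensurator p = \pi_commensurator q <-> fiso_equiv p q.
Proof.
split=> [/eqmodP/asboolP//|pq]; exact/eqmodP/asboolP.
Qed.

Lemma repr_fiso_equiv p : fiso_equiv (repr (\pi_commensurator p)) p.
Proof. by apply/comm_eqP; rewrite reprK. Qed.

Definition comm_mul (a b : commensurator) : commensurator :=
  \pi_commensurator (comp_fiso (repr a) (repr b)).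
Definition comm_one : commensurator := \pi_commensurator id_fiso.
Definition comm_inv (a : commensurator) : commensurator := \pi_commensurator (inv_fiso (repr a)).

Lemma comm_mul_pi p q :
  comm_mul (\pi_commensurator p) (\pi_commensurator q) = \pi_commensurator (comp_fiso p q).
Proof. by apply/comm_eqP/comp_fiso_equiv; apply: repr_fiso_equiv. Qed.

Lemma comm_inv_pi p : comm_inv (\pi_commensurator p) = \pi_commensurator (inv_fiso p).
Proof. by apply/comm_eqP/inv_fiso_equiv; apply: repr_fiso_equiv. Qed.

Lemma comm_mulA : associative comm_mul.
Proof.
elim/quotW=> p; elim/quotW=> q; elim/quotW=> r.
rewrite (comm_mul_pi q r) (comm_mul_pi p q) 2!comm_mul_pi.
by apply/comm_eqP/fiso_equiv_dom => x [[rx qx] px].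
Qed.

Lemma comm_mul1 : left_id comm_one comm_mul.
Proof.
elim/quotW=> p; rewrite comm_mul_pi.
by apply/comm_eqP/fiso_equiv_dom => x [].
Qed.

Lemma comm_1mul : right_id comm_one comm_mul.
Proof.
elim/quotW=> p; rewrite comm_mul_pi.
by apply/comm_eqP/fiso_equiv_dom => x [].
Qed.

Lemma comm_mulV : left_inverse comm_one comm_inv comm_mul.
Proof.
elim/quotW=> p; rewrite comm_inv_pi comm_mul_pi.
by apply/comm_eqP/fiso_equiv_dom => x [px _]; split=> //=; apply: inv_funK.
Qed.

Lemma comm_Vmul : right_inverse comm_one comm_inv comm_mul.
Proof.
elim/quotW=> p; rewrite comm_inv_pi comm_mul_pi.
by apply/comm_eqP/fiso_equiv_dom => x [/inv_funP[_ e] _].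
Qed.

HB.instance Definition _ := isGroup.Build commensurator
  comm_mulA comm_mul1 comm_1mul comm_mulV comm_Vmul.

End Commensurator.

Section FreeGroup.
Variable X : choiceType.

(* The letter (x, false) stands for the generator x, (x, true) for x^-1. *)
Definition letter : Type := X * bool.
HB.instance Definition _ := Choice.on letter.

Definition inv_letter (a : letter) : letter := (a.1, ~~ a.2).

Definition reduced (w : seq letter) := sorted (fun a b => b != inv_letter a) w.

Record free_group := FreeWord {
  free_word :> seq letter;
  free_wordP : reduced free_word }.

HB.instance Definition _ := [isSub for free_word].
HB.instance Definition _ := [Choice of free_group by <:].

(* The reduced form of a :: w, for w reduced. *)
Definition push (a : letter) (w : seq letter) :=
  if w is b :: w' then if b == inv_letter a then w' else a :: w else [:: a].

(* The reduced form of u ++ v, for v reduced. *)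
Definition pushs (u v : seq letter) := foldr push v u.

Lemma inv_letterK : involutive inv_letter.
Proof. by case=> x b; rewrite /inv_letter /= negbK. Qed.

Lemma inv_letter_neq a : a != inv_letter a.
Proof. by case: a => x []; rewrite /inv_letter xpair_eqE andbF. Qed.

Lemma push_reduced a w : reduced w -> reduced (push a w).
Proof.
case: w => [|b w] //=; case: ifPn => [_|ne /= ->]; last by rewrite ne.
exact: path_sorted.
Qed.

Lemma pushs_reduced u v : reduced v -> reduced (pushs u v).
Proof. by move=> rv; elim: u => //= a u; apply: push_reduced. Qed.

Lemma push_cons a w : reduced (a :: w) -> push a w = a :: w.
Proof. by case: w => [|b w] //= /andP[/negPf ->]. Qed.

Lemma pushK a w : reduced w -> push a (push (inv_letter a) w) = w.
Proof.
case: w => [|b w] rw /=; first by rewrite eqxx.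
rewrite inv_letterK; have [ba|ba] := eqVneq b a.
  by rewrite -ba push_cons.
by rewrite /= eqxx.
Qed.

Lemma pushs_push a u v : reduced v -> pushs (push a u) v = push a (pushs u v).
Proof.
move=> rv; case: u => [|b u] //=; case: eqP => [-> //|//].
by rewrite pushK //; apply: pushs_reduced.
Qed.

Lemma pushsA u v w : reduced w -> pushs u (pushs v w) = pushs (pushs u v) w.
Proof. by move=> rw; elim: u => //= a u ->; rewrite pushs_push. Qed.

Lemma pushs0 u : reduced u -> pushs u [::] = u.
Proof.
elim: u => //= a u IH ru; rewrite IH ?push_cons //.
exact: path_sorted ru.
Qed.

Definition inv_word (u : seq letter) := rev (map inv_letter u).

Lemma inv_wordK : involutive inv_word.
Proof. by move=> u; rewrite /inv_word map_rev revK mapK //; apply: inv_letterK. Qed.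

Lemma inv_word_reduced u : reduced u -> reduced (inv_word u).
Proof.
rewrite /reduced /inv_word rev_sorted sorted_map => /sub_sorted; apply.
move=> a b /=; rewrite (can_eq inv_letterK); apply: contra => /eqP ->.
by rewrite inv_letterK.
Qed.

Lemma pushs_inv u v : reduced v -> pushs u (pushs (inv_word u) v) = v.
Proof.
elim: u v => //= a u IH v rv.
rewrite /inv_word map_cons rev_cons /pushs -cats1 foldr_cat /= -/(pushs _ _).
by rewrite (IH (push _ _)) ?pushK //; apply: push_reduced.
Qed.

Definition free_mul (u v : free_group) : free_group :=
  FreeWord (pushs_reduced u (free_wordP v)).
Definition free_one : free_group := @FreeWord [::] isT.
Definition free_inv (u : free_group) : free_group :=
  FreeWord (inv_word_reduced (free_wordP u)).

Lemma free_mulA : associative free_mul.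
Proof. by move=> u v w; apply: val_inj; apply/pushsA/free_wordP. Qed.

Lemma free_mul1 : left_id free_one free_mul.
Proof. by move=> u; apply: val_inj. Qed.

Lemma free_1mul : right_id free_one free_mul.
Proof. by move=> u; apply: val_inj; apply/pushs0/free_wordP. Qed.

Lemma free_Vmul : right_inverse free_one free_inv free_mul.
Proof.
move=> u; apply: val_inj; have := pushs_inv u (isT : reduced [::]).
by rewrite pushs0 //; apply/inv_word_reduced/free_wordP.
Qed.

Lemma free_mulV : left_inverse free_one free_inv free_mul.
Proof.
move=> u; have := free_Vmul (free_inv u); congr (free_mul _ _ = _).
by apply: val_inj; apply: inv_wordK.
Qed.

HB.instance Definition _ := isGroup.Build free_group
  free_mulA free_mul1 free_1mul free_mulV free_Vmul.

Definition free_gen (x : X) : free_group :=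
  @FreeWord [:: (x, false)] isT.

Section UniversalProperty.
Variables (H : groupType) (g : X -> H).

Definition letter_val (a : letter) : H := if a.2 then (g a.1)^-1 else g a.1.

Definition free_lift (u : free_group) : H :=
  \prod_(a <- free_word u) letter_val a.

Lemma letter_valV a : letter_val (inv_letter a) = (letter_val a)^-1.
Proof. by case: a => x []; rewrite /letter_val /= ?invgK. Qed.

Lemma letter_val_pushs u v :
  \prod_(a <- pushs u v) letter_val a =
  (\prod_(a <- u) letter_val a) * \prod_(a <- v) letter_val a.
Proof.
elim: u => [|a u IH] /=; first by rewrite big_nil mul1g.
rewrite big_cons -mulgA -IH; case: (pushs u v) => [|b w] /=.
  by rewrite big_seq1 big_nil mulg1.
by case: eqP => [->|_]; rewrite !big_cons // letter_valV mulVKg.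
Qed.

Lemma free_liftM : {morph free_lift : u v / u * v}.
Proof. by move=> u v; apply: letter_val_pushs. Qed.

HB.instance Definition _ :=
  isMultiplicative.Build free_group H free_lift free_liftM.

Lemma free_lift_gen x : free_lift (free_gen x) = g x.
Proof. exact: big_seq1. Qed.

Lemma free_lift_unique (f : {multiplicative free_group -> H}) :
  (forall x, f (free_gen x) = g x) -> f =1 free_lift.
Proof.
move=> fg; have f1 : f 1 = 1.
  by apply: (mulgI (f 1)); rewrite -gmulfM !mulg1.
have fa (a : letter) : f (@FreeWord [:: a] isT) = letter_val a.
  case: a => x [] /=; last exact: fg.
  apply: (mulgI (f (free_gen x))); rewrite -gmulfM fg mulgV -f1.
  by congr (f _); apply: val_inj; rewrite /= /inv_letter /= eqxx.
case=> w; rewrite /free_lift /=; elim: w => [|a w IH] rw.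
  by rewrite big_nil -f1; congr (f _); apply: val_inj.
have rw' : reduced w := path_sorted rw.
rewrite big_cons -(IH rw') -fa -gmulfM; congr (f _); apply: val_inj => /=.
by rewrite push_cons.
Qed.

End UniversalProperty.

End FreeGroup.

(* Main.v *)
From HB Require Import structures.
Require Import Defs.
From mathcomp Require Import all_boot.
From mathcomp Require Import boolp classical_sets functions cardinality.
From mathcomp Require Import ssralg ssrint intdiv zify.

Set Implicit Arguments.
Unset Strict Implicit.
Unset Printing Implicit Defensive.

(** Let t be a free generator of F and let height(w) be the exponent sum of t
    in w. The subgroup K_N = {w | N divides height(w)} has finite index, and is
    freely generated by t^N and the t^i x t^-i for 0 <= i < N and x another
    generator. A permutation s of Z that commutes with the translation by N
    induces the automorphism t^i x t^-i |-> t^(s i) x t^-(s i), t^N |-> t^N of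
    K_N. These automorphisms compose as the permutations do and are compatible
    with replacing N by a multiple, so the periodic permutations of Z act by
    commensurations. If s 0 <> r 0, the images of x^m under s and r differ for
    all m > 0, so s and r give different commensurations.

    It remains to let L act on Z by periodic permutations, freely at 0. Write L
    as the union of a chain of finite subgroups L_n, and list L_(n+1) as
    successive right cosets of L_n, each in the order of the list of L_n.
    Cutting Z into blocks of length |L_n|, each a copy of the list of L_n, lets
    L_n act by left multiplication on each block, and the action of L_(n+1)
    extends that of L_n. *)

(** * Integer powers in a group *)

Section IntegerPower.
Local Open Scope group_scope.
Variables (G : groupType) (g : G).

Definition zpow (z : int) : G :=
  match z with Posz n => g ^+ n | Negz n => g ^- n.+1 end.

Lemma zpowS z : zpow (z + 1)%R = zpow z * g.
Proof.
case: z => [n|[|n]].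
- by rewrite (_ : (n%:Z + 1)%R = n.+1) /= ?expgSr //; lia.
- by rewrite /= mulVg.
- rewrite (_ : (Negz n.+1 + 1)%R = Negz n); last by lia.
  by rewrite /= [g ^+ n.+2]expgS invgM mulgVK.
Qed.

Lemma zpowD y z : zpow (y + z)%R = zpow y * zpow z.
Proof.
elim: z => [|n IH|n IH]; first by rewrite GRing.addr0 mulg1.
- by rewrite -addn1 PoszD GRing.addrA !zpowS IH mulgA.
- apply: (mulIg g); rewrite -mulgA -!zpowS -addn1 PoszD.
  by rewrite GRing.opprD -GRing.addrA !GRing.subrK.
Qed.

Lemma zpowN z : zpow (- z)%R = (zpow z)^-1.
Proof. by apply: (mulgI (zpow z)); rewrite -zpowD GRing.subrr mulgV. Qed.
End IntegerPower.

(** * The exponent sum of t *)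

Section Height.
Local Open Scope group_scope.
Variables (X : choiceType) (t : X).
Implicit Types (u v : free_group X) (h z : int).

Definition letter_height (a : letter X) : int :=
  if a.1 == t then if a.2 then (-1)%R else 1%R else 0%R.

Definition word_height (w : seq (letter X)) : int :=
  foldr (fun a => GRing.add (letter_height a)) 0%R w.

Definition height u := word_height u.

Lemma letter_heightV a : letter_height (inv_letter a) = (- letter_height a)%R.
Proof. by case: a => x [] /=; rewrite /letter_height /=; case: eqP. Qed.

Lemma word_height_push a w :
  word_height (push a w) = (letter_height a + word_height w)%R.
Proof.
case: w => [|b w] //=; case: eqP => [->|//].
by rewrite letter_heightV GRing.addNKr.
Qed.

Lemma heightM u v : height (u * v) = (height u + height v)%R.
Proof.
rewrite /height /=; elim: (free_word u) => [|a w IH] /=; first by rewrite GRing.add0r.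
by rewrite word_height_push IH GRing.addrA.
Qed.

Lemma height1 : height 1 = 0%R. Proof. by []. Qed.

Lemma heightV u : height u^-1 = (- height u)%R.
Proof.
by apply: (GRing.addrI (height u)); rewrite -heightM mulgV GRing.subrr.
Qed.

Lemma height_gen x : height (free_gen x) = if x == t then 1%R else 0%R.
Proof. by rewrite /height /= /letter_height; case: eqP. Qed.

Lemma height_zpow z : height (zpow (free_gen t) z) = z.
Proof.
have hP n : height (zpow (free_gen t) (Posz n)) = n.
  elim: n => [//|n IH].
  by rewrite -addn1 PoszD zpowS heightM IH height_gen eqxx.
by case: (intP z) => [|n|n]; rewrite ?hP // zpowN heightV hP.
Qed.

(** * Crossed homomorphisms on the free group *)

Section Cocycle.
Variables (H : groupType) (val : int -> X -> H).

(* The argument h is the height at which the word starts: [cocycle] is the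
   crossed homomorphism that ignores t and sends a letter x read at height h
   to [val h x]. *)
Definition letter_cocycle h (a : letter X) : H :=
  if a.1 == t then 1 else if a.2 then (val h a.1)^-1 else val h a.1.

Fixpoint word_cocycle h (w : seq (letter X)) : H :=
  if w is a :: w' then letter_cocycle h a * word_cocycle (h + letter_height a)%R w'
  else 1.

Definition cocycle h u : H := word_cocycle h u.

Lemma letter_cocycleV h a :
  letter_cocycle (h + letter_height a)%R (inv_letter a) = (letter_cocycle h a)^-1.
Proof.
case: a => x b; rewrite /letter_cocycle /letter_height /=.
case: eqP => _; first by rewrite invg1.
by rewrite GRing.addr0; case: b; rewrite //= invgK.
Qed.

Lemma word_cocycle_push h a w : word_cocycle h (push a w) =
  letter_cocycle h a * word_cocycle (h + letter_height a)%R w.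
Proof.
case: w => [|b w] //=; case: eqP => [->|//].
by rewrite letter_cocycleV letter_heightV GRing.addrK mulVKg.
Qed.

Lemma cocycleM h u v :
  cocycle h (u * v) = cocycle h u * cocycle (h + height u)%R v.
Proof.
rewrite /cocycle /height /=.
elim: (free_word u) h => [|a w IH] h /=; first by rewrite GRing.addr0 mul1g.
by rewrite word_cocycle_push IH mulgA GRing.addrA.
Qed.

Lemma cocycle1 h : cocycle h 1 = 1. Proof. by []. Qed.

Lemma cocycleV h u : cocycle h u^-1 = (cocycle (h - height u)%R u)^-1.
Proof.
apply: (mulgI (cocycle (h - height u)%R u)).
by rewrite mulgV -{2}(GRing.subrK (height u) h) -cocycleM mulgV.
Qed.

Lemma cocycle_gen h x : x != t -> cocycle h (free_gen x) = val h x.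
Proof. by rewrite /cocycle /= /letter_cocycle /= mulg1 => /negPf ->. Qed.

Lemma cocycle_t h : cocycle h (free_gen t) = 1.
Proof. by rewrite /cocycle /= /letter_cocycle /= mulg1 eqxx. Qed.

Lemma cocycle_zpow h z : cocycle h (zpow (free_gen t) z) = 1.
Proof.
have cP n h' : cocycle h' (zpow (free_gen t) (Posz n)) = 1.
  elim: n => [//|n IH].
  by rewrite -addn1 PoszD zpowS cocycleM IH cocycle_t mulg1.
by case: (intP z) => [|n|n]; rewrite ?cP // zpowN cocycleV cP invg1.
Qed.

Lemma cocycle_conj h z u : height u = 0%R ->
  cocycle h (zpow (free_gen t) z * u * zpow (free_gen t) (- z)%R) =
  cocycle (h + z)%R u.
Proof. by move=> u0; rewrite !cocycleM !cocycle_zpow height_zpow mul1g mulg1. Qed.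

Lemma cocycleX h u n : height u = 0%R -> cocycle h (u ^+ n) = cocycle h u ^+ n.
Proof.
by move=> u0; elim: n => // n IH; rewrite !expgS cocycleM u0 GRing.addr0 IH.
Qed.
End Cocycle.

(** Reduces identities between crossed homomorphisms to their values on generators. *)
Lemma free_group_ind (P : free_group X -> Prop) :
  P 1 -> (forall x, P (free_gen x)) -> (forall u, P u -> P u^-1) ->
  (forall u v, P u -> P v -> P (u * v)) -> forall u, P u.
Proof.
move=> P1 Pgen PV PM [w]; elim: w => [|[x b] w IH] rw.
  by rewrite (_ : FreeWord rw = 1) //; apply: val_inj.
have rw' := path_sorted rw.
have -> : FreeWord rw =
    (if b then (free_gen x)^-1 else free_gen x) * FreeWord rw'.
  by apply: val_inj; case: b rw => rw; rewrite /= push_cons.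
by apply: PM; [case: b rw => _ //; exact: PV | exact: IH].
Qed.

(** * Maps of the free group induced by maps of Z *)

Section Twist.
Local Notation T := (zpow (free_gen t)).

Definition conj_gen (s : int -> int) h x : free_group X :=
  T (s h) * free_gen x * T (- s h)%R.

(* Only multiplicative on the subgroups [height_dvd N] such that s commutes with
   the translation by N, but functorial in s on the whole free group. *)
Definition twist s u : free_group X := cocycle (conj_gen s) 0%R u * T (height u).

Lemma height_cocycle_conj s h u : height (cocycle (conj_gen s) h u) = 0%R.
Proof.
elim/free_group_ind: u h => [|x|u IH|u v IHu IHv] h //.
- have [->|xt] := eqVneq x t; first by rewrite cocycle_t.
  rewrite cocycle_gen // !heightM !height_zpow height_gen (negPf xt).
  by rewrite GRing.addr0 GRing.subrr.
- by rewrite cocycleV heightV IH.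
- by rewrite cocycleM heightM IHu IHv.
Qed.

Lemma height_twist s u : height (twist s u) = height u.
Proof. by rewrite heightM height_cocycle_conj height_zpow GRing.add0r. Qed.

(** The outer map reads a factor t^(r h) x t^-(r h) from height 0, so it meets x at height r h and
    produces t^(s (r h)) x t^-(s (r h)). The factor has height 0, so the next one is again read from
    height 0. *)
Lemma cocycle_conj_comp s r h u :
  cocycle (conj_gen s) 0%R (cocycle (conj_gen r) h u) =
  cocycle (conj_gen (s \o r)) h u.
Proof.
elim/free_group_ind: u h => [|x|u IH|u v IHu IHv] h //.
- have [->|xt] := eqVneq x t; first by rewrite !cocycle_t.
  rewrite !cocycle_gen // cocycle_conj ?height_gen ?(negPf xt) //.
  by rewrite GRing.add0r cocycle_gen.
- by rewrite !cocycleV height_cocycle_conj GRing.subr0 IH.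
- by rewrite !cocycleM height_cocycle_conj GRing.addr0 IHu IHv.
Qed.

Lemma twist_comp s r u : twist s (twist r u) = twist (s \o r) u.
Proof.
rewrite {1}/twist height_twist /twist cocycleM cocycle_conj_comp.
by rewrite cocycle_zpow mulg1.
Qed.

(** Read at height h, a generator g contributes t^h g t^-(h + height g), which is trivial for g = t;
    these factors telescope. *)
Lemma cocycle_conj_id h u :
  cocycle (conj_gen id) h u = T h * u * T (- (h + height u))%R.
Proof.
elim/free_group_ind: u h => [|x|u IH|u v IHu IHv] h.
- by rewrite mulg1 GRing.addr0 zpowN mulgV.
- have [->|xt] := eqVneq x t.
    rewrite cocycle_t height_gen eqxx -[free_gen t](mul1g (free_gen t)).
    by rewrite -(zpowS _ 0%R) -!zpowD GRing.add0r GRing.subrr.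
  by rewrite cocycle_gen // height_gen (negPf xt) GRing.addr0.
- rewrite cocycleV IH heightV !invgM -!zpowN mulgA.
  by rewrite GRing.subrK GRing.opprK.
- rewrite cocycleM IHu IHv heightM !mulgA GRing.addrA.
  by rewrite -(mulgA (_ * u)) -zpowD GRing.addNr mulg1.
Qed.

Lemma twist_id u : twist id u = u.
Proof.
by rewrite /twist cocycle_conj_id GRing.add0r mul1g zpowN mulgVK.
Qed.

Lemma eq_twist s r : s =1 r -> twist s =1 twist r.
Proof. by move=> sr; have -> : s = r by apply: funext. Qed.

Definition periodic (N : nat) (s : int -> int) :=
  forall h, s (h + N%:Z)%R = (s h + N%:Z)%R.

Lemma periodicM N s q h : periodic N s ->
  s (h + q * N%:Z)%R = (s h + q * N%:Z)%R.
Proof.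
move=> sN; elim: q h => [|n IH|n IH] h; first by rewrite GRing.mul0r !GRing.addr0.
  by rewrite -addn1 PoszD GRing.mulrDl GRing.mul1r !GRing.addrA sN IH.
apply: (GRing.addIr (Posz N)); rewrite -sN -!GRing.addrA.
have -> : (- n.+1%:Z * N%:Z + N%:Z = - n%:Z * N%:Z :> int)%R by lia.
exact: IH.
Qed.

(** By periodicity, raising the starting height by qN conjugates every factor by t^(qN). *)
Lemma cocycle_conj_shift N s q h u : periodic N s ->
  cocycle (conj_gen s) (h + q * N%:Z)%R u =
  T (q * N%:Z)%R * cocycle (conj_gen s) h u * T (- (q * N%:Z))%R.
Proof.
move=> sN; elim/free_group_ind: u h => [|x|u IH|u v IHu IHv] h.
- by rewrite !cocycle1 mulg1 zpowN mulgV.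
- have [->|xt] := eqVneq x t; first by rewrite !cocycle_t mulg1 zpowN mulgV.
  rewrite !cocycle_gen // /conj_gen periodicM // GRing.addrC GRing.opprD.
  by rewrite [X in _ * T X = _]GRing.addrC !zpowD !mulgA.
- by rewrite !cocycleV GRing.addrAC IH !invgM -!zpowN GRing.opprK !mulgA.
- rewrite !cocycleM GRing.addrAC IHu IHv !mulgA.
  by rewrite zpowN mulgVK.
Qed.

(** Inside u v, the word v is read from the height of u. As this is a multiple of N, the effect is
    conjugation by t^(height u), which the final power of t in [twist] absorbs. *)
Lemma twistM N s u v : periodic N s -> (N %| height u)%Z ->
  twist s (u * v) = twist s u * twist s v.
Proof.
move=> sN /dvdzP[q hu]; rewrite /twist cocycleM heightM hu cocycle_conj_shift //.
by rewrite !mulgA zpowD zpowN !mulgA mulgVK.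
Qed.

Definition height_dvd (N : nat) : set (free_group X) :=
  [set u | (N %| height u)%Z].

Lemma subgroup_height_dvd N : subgroup (height_dvd N).
Proof.
split=> [|u v]; first exact: dvdz0.
by rewrite /height_dvd /= heightM heightV => uN vN; apply: GRing.rpredB.
Qed.

Lemma finite_index_height_dvd N : (0 < N)%N -> finite_index (height_dvd N).
Proof.
move=> N0; have N_neq0 : Posz N != 0%R by lia.
apply/(finite_indexP (subgroup_height_dvd N)).
exists nat, (fun u => `|(height u %% N)%Z|%N); split.
  apply: (sub_finite_set _ (finite_II N)) => _ [u _ <-] /=.
  by have := @ltz_pmod (height u) N N0; have := modz_ge0 (height u) N_neq0; lia.
move=> u v /(congr1 Posz); rewrite !gez0_abs ?modz_ge0 //.
move=> /eqP; rewrite eq_sym eqz_mod_dvd /height_dvd /= heightM heightV.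
by rewrite GRing.addrC.
Qed.

Section PeriodicTwist.
Variables (N : nat) (s s' : int -> int).
Hypotheses (N0 : (0 < N)%N) (sN : periodic N s).
Hypotheses (sK : cancel s s') (s'K : cancel s' s).

Lemma twist_morph : {in height_dvd N &, {morph twist s : u v / u * v}}.
Proof. by move=> u v /set_mem uN _; apply: twistM sN uN. Qed.

Lemma twistK : cancel (twist s) (twist s').
Proof.
by move=> u; rewrite twist_comp (@eq_twist _ id) ?twist_id // => h; apply: sK.
Qed.

Lemma twistVK : cancel (twist s') (twist s).
Proof.
by move=> u; rewrite twist_comp (@eq_twist _ id) ?twist_id // => h; apply: s'K.
Qed.

Lemma twist_bij : set_bij (height_dvd N) (height_dvd N) (twist s).
Proof.
split=> [u|u v _ _|u uN]; first by rewrite /height_dvd /= height_twist.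
  exact: (can_inj twistK).
exists (twist s' u); last exact: twistVK.
by rewrite /height_dvd /= height_twist.
Qed.

Definition twist_fiso : fiso (free_group X) :=
  FIso (subgroup_height_dvd N) (subgroup_height_dvd N)
    (finite_index_height_dvd N0) (finite_index_height_dvd N0)
    twist_morph twist_bij.
End PeriodicTwist.

End Twist.
End Height.

(** * From periodic actions on Z to commensurations *)

Section Embedding.
Local Open Scope group_scope.

(** Pigeonhole: two powers of g with distinct exponents share a coset of K, and their quotient is a
    positive power of g. *)
Lemma finite_index_expg (G : groupType) (K : set G) (g : G) :
  subgroup K -> finite_index K -> exists2 m, (0 < m)%N & K (g ^+ m).
Proof.
move=> sK /(finite_indexP sK)[T [c [fc cP]]].
have [n [m [nm cnm]]] : exists n m, (n < m)%N /\ c (g ^+ n) = c (g ^+ m).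
  apply: contrapT => no; apply: infinite_nat.
  apply: (sub_finite_set _ (@finite_preimage _ _ _ (fun n => c (g ^+ n)) _ fc)).
    by move=> n _ /=; exists (g ^+ n).
  move=> n m _ _ e; case: (ltngtP n m) => // lt_nm; case: no.
    by exists n, m.
  by exists m, n.
exists (m - n)%N; first by rewrite subn_gt0.
have := cP _ _ cnm; congr (K _).
by rewrite -{1}(subnKC (ltnW nm)) expgnDr mulKg.
Qed.

Lemma free_genX_neq1 (X : choiceType) (x : X) m :
  (0 < m)%N -> free_gen x ^+ m <> 1.
Proof.
move=> m0 /(congr1 (height x)); rewrite height1.
have -> : height x (free_gen x ^+ m) = m by exact: (height_zpow x m).
by case: m m0.
Qed.

Lemma commensurator_of_periodic_action (X : choiceType) (t x : X)
    (L : groupType) (act : L -> int -> int) :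
  x != t ->
  act 1 =1 id -> (forall a b, act (a * b) =1 act a \o act b) ->
  (forall a, exists N, (0 < N)%N /\ periodic N (act a)) ->
  (forall a, act a 0%R = 0%R -> a = 1) ->
  exists f : {multiplicative L -> commensurator (free_group X)}, injective f.
Proof.
move=> xt act1 actM actN act_free.
have actK a : cancel (act a) (act a^-1).
  by move=> h; have := actM a^-1 a h; rewrite mulVg act1.
have actVK a : cancel (act a^-1) (act a).
  by move=> h; have := actM a a^-1 h; rewrite mulgV act1.
have [N NP] := boolp.choice actN.
pose F a := twist_fiso t (NP a).1 (NP a).2 (@actK a) (@actVK a).
pose f a : commensurator (free_group X) :=
  (\pi_(commensurator (free_group X)) (F a))%qT.
have fM : {morph f : a b / a * b}.
  move=> a b; rewrite /f [RHS]comm_mul_pi; apply/comm_eqP.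
  (* The periods chosen for a, b and a b are unrelated, so the two sides are compared on an
     intersection. *)
  exists (height_dvd t (N (a * b)) `&`
          (height_dvd t (N a) `&` height_dvd t (N b)))%classic.
  have sH := @subgroup_height_dvd X t.
  have fH c : finite_index (height_dvd t (N c)).
    by apply: finite_index_height_dvd; case: (NP c).
  split.
  - exact/subgroupI/subgroupI.
  - by apply: finite_indexI (fH _) (finite_indexI _ _ (fH _) (fH _)) => //;
      apply: subgroupI.
  - move=> u [abu [au bu]]; split=> //; split=> //=.
    by rewrite /height_dvd /= height_twist.
  - by move=> u _ /=; rewrite twist_comp; apply: eq_twist; exact: actM.
have f_inj : injective f.
  move=> a b /comm_eqP[K [sK fK _ eK]].
  have [m m0 Kxm] := finite_index_expg (free_gen x) sK fK.
  have height_xm : height t (free_gen x ^+ m) = 0%R.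
    by elim: (m) => // n IH; rewrite expgS heightM IH height_gen (negPf xt).
  (* The word x^m is read entirely at height 0, so its images detect the values of the actions at
     0. *)
  have ab0 : act a 0%R = act b 0%R.
    apply: contrapT => ne; apply: (@free_genX_neq1 X x m m0).
    (* The crossed homomorphism [at_a] keeps only the letters read at height
       [act a 0], so it separates the two images of [x ^+ m]. *)
    pose at_a (h : int) (y : X) := if h == act a 0%R then free_gen y else 1.
    have : cocycle t at_a 0%R (F a (free_gen x ^+ m)) =
           cocycle t at_a 0%R (F b (free_gen x ^+ m)) by rewrite eK // inE.
    have eF c : cocycle t at_a 0%R (F c (free_gen x ^+ m)) =
                (at_a (act c 0%R) x) ^+ m.
      have hx : height t (free_gen x) = 0%R by rewrite height_gen (negPf xt).
      rewrite /= /twist height_xm mulg1 cocycleX // cocycle_gen //.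
      rewrite cocycleX ?cocycle_conj ?GRing.add0r ?cocycle_gen //.
      by rewrite !heightM !height_zpow hx GRing.addr0 GRing.subrr.
    by rewrite !eF /at_a eqxx; case: eqP => [/esym//|_]; rewrite expg1n.
  apply: (mulgI b^-1); rewrite mulVg; apply: act_free.
  by rewrite actM /= ab0 actK.
pose f_mul := isMultiplicative.Build L (commensurator (free_group X)) f fM.
pose g : {multiplicative L -> commensurator (free_group X)} := HB.pack f f_mul.
by exists g.
Qed.
End Embedding.

(** * Periodic actions from enumerations of finite subgroups *)

Section EnumerationAction.
Local Open Scope group_scope.
Variable L : groupType.
Implicit Types (A : set L) (s r : seq L) (a b : L) (q z : int).

Definition enumerates s A := uniq s /\ (forall x, x \in s <-> A x).

(* Z is cut into blocks of length [size s], each a copy of the subgroup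
   enumerated by s, on which a acts by left multiplication. *)
Definition block_act s a z : int :=
  ((z %/ size s)%Z * size s + index (a * nth 1 s `|(z %% size s)%Z|%N)%g s)%R.

Lemma block_actE s a q i : (i < size s)%N ->
  block_act s a (q * size s + i)%R = (q * size s + index (a * nth 1 s i)%g s)%R.
Proof.
move=> i_lt; have N0 : (Posz (size s) != 0)%R by lia.
by rewrite /block_act divzMDl // modzMDl divz_small ?modz_small ?GRing.addr0.
Qed.

Lemma block_split (N : nat) z : (0 < N)%N ->
  exists q i, (i < N)%N /\ z = (q * N + Posz i)%R.
Proof.
move=> N0; have N_neq0 : (Posz N != 0)%R by lia.
exists (z %/ N)%Z, `|(z %% N)%Z|%N.
have := modz_ge0 z N_neq0; have := @ltz_pmod z N N0 => lt ge; split; first by lia.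
by rewrite gez0_abs // -divz_eq.
Qed.

Section Subgroup.
Variables (A : set L) (s : seq L).
Hypotheses (sA : subgroup A) (sE : enumerates s A).

Lemma size_enum_gt0 : (0 < size s)%N.
Proof.
have : 1 \in s by apply/sE.2; case: sA.
by case: (s).
Qed.

Lemma mulg_enum a b : A a -> b \in s -> a * b \in s.
Proof. by move=> Aa /sE.2 Ab; apply/sE.2; exact: subgroupM. Qed.

Lemma block_act1 : block_act s 1 =1 id.
Proof.
move=> z; have [q [i [lt_i ->]]] := block_split z size_enum_gt0.
by rewrite block_actE // mul1g index_uniq //; exact: sE.1.
Qed.

Lemma block_actM a b : A a -> A b ->
  block_act s (a * b) =1 block_act s a \o block_act s b.
Proof.
move=> Aa Ab z; have [q [i [lt_i ->]]] := block_split z size_enum_gt0.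
have bi : b * nth 1 s i \in s by apply: mulg_enum => //; apply: mem_nth.
by rewrite /= !block_actE ?index_mem // nth_index // mulgA.
Qed.

Lemma block_act_periodic a : periodic (size s) (block_act s a).
Proof.
move=> z; have [q [i [lt_i ->]]] := block_split z size_enum_gt0.
have -> : (q * size s + i + size s = (q + 1) * size s + i :> int)%R by lia.
by rewrite !block_actE //; lia.
Qed.

(** Position 0 holds the first entry of [s], and left multiplication by a fixes an element only if a
    = 1. *)
Lemma block_act_free a : A a -> block_act s a 0%R = 0%R -> a = 1.
Proof.
move=> Aa; have := @block_actE s a 0%R 0%N size_enum_gt0.
rewrite GRing.mul0r !GRing.add0r => -> [/(congr1 (nth 1 s))].
have s0 : nth 1 s 0 \in s by apply/mem_nth/size_enum_gt0.
rewrite nth_index ?mulg_enum // => e.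
by apply: (mulIg (nth 1 s 0)); rewrite mul1g.
Qed.
End Subgroup.

(** Taking the first suitable entry of [r] makes the representative depend only on the right coset
    of x. *)
Definition coset_rep s r x := nth 1 r (find (fun y => y / x \in s) r).

(* Lists the group enumerated by r as successive right cosets of the subgroup
   enumerated by s, each in the order of s. *)
Definition extend s r :=
  [seq a * c | c <- undup [seq coset_rep s r x | x <- r], a <- s].

Section Extend.
Variables (A B : set L) (s r : seq L).
Hypotheses (sA : subgroup A) (sB : subgroup B) (AB : (A `<=` B)%classic).
Hypotheses (sE : enumerates s A) (rE : enumerates r B).

Lemma coset_repP x : B x -> B (coset_rep s r x) /\ A (coset_rep s r x / x).
Proof.
move=> Bx; have hr : has (fun y => y / x \in s) r.
  by apply/hasP; exists x; [apply/rE.2 | apply/sE.2; rewrite mulgV; case: sA].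
split; first by apply/rE.2/mem_nth; rewrite -has_find.
exact/sE.2/(nth_find 1 hr).
Qed.

Lemma coset_rep_mull a x : A a -> coset_rep s r (a * x) = coset_rep s r x.
Proof.
move=> Aa; rewrite /coset_rep; congr (nth _ _ _); apply: eq_find => y.
rewrite invgM mulgA; apply/idP/idP => /sE.2 yA; apply/sE.2.
  by rewrite -[y / x](mulgVK a); exact: subgroupM.
by case: sA => _; apply.
Qed.

Lemma coset_rep_idem x : B x -> coset_rep s r (coset_rep s r x) = coset_rep s r x.
Proof.
by move=> /coset_repP[_ Ac]; rewrite -[X in coset_rep s r X](mulgVK x) coset_rep_mull.
Qed.

Lemma extend_enumerates : enumerates (extend s r) B.
Proof.
have repP c : c \in undup [seq coset_rep s r x | x <- r] ->
    B c /\ coset_rep s r c = c.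
  rewrite mem_undup => /mapP[x /rE.2 Bx ->].
  by split; [case: (coset_repP Bx) | exact: coset_rep_idem].
split=> [|x].
  apply: allpairs_uniq; [exact: undup_uniq | exact: sE.1 |].
  move=> p p' /allpairsP[[c a] /= [cT /sE.2 Aa ->]].
  move=> /allpairsP[[c' a'] /= [c'T /sE.2 Aa' ->]] /= e.
  have [[_ cK] [_ c'K]] := (repP _ cT, repP _ c'T).
  (* The representative c is recovered from the product a c by [coset_rep]. *)
  have cc' : c = c' by rewrite -cK -c'K -(coset_rep_mull c Aa) e coset_rep_mull.
  by move: e; rewrite cc' => /mulIg->.
split=> [/allpairsP[[c a] /= [/repP[Bc _] /sE.2 Aa ->]]|Bx].
  by apply: subgroupM => //; apply: AB.
have [Bc Acx] := coset_repP Bx.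
apply/allpairsP; exists (coset_rep s r x, x / coset_rep s r x); split => /=.
- by rewrite mem_undup; apply/map_f/rE.2.
- by apply/sE.2; rewrite -[x in x / _]invgK -invgM; exact: subgroupV.
- by rewrite mulgVK.
Qed.

Lemma nth_cosets (u : seq L) i j : (i < size s)%N -> (j < size u)%N ->
  nth 1 [seq a * c | c <- u, a <- s] (j * size s + i) = nth 1 s i * nth 1 u j.
Proof.
move=> lt_i; elim: u j => [|c u IH] [|j] // lt_j; rewrite /= nth_cat size_map.
  by rewrite lt_i (nth_map 1).
by rewrite mulSn -addnA ltnNge leq_addr /= addKn IH.
Qed.

(** A block of [extend s r] is a run of blocks of [s], each translated on the right by a
    representative. Left multiplication by a in A commutes with these translations, so it permutes
    positions inside each small block as it does in [s]. *)
Lemma block_act_extend a : A a -> block_act (extend s r) a =1 block_act s a.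
Proof.
move=> Aa z; have N0 := size_enum_gt0 sA sE.
have M0 := size_enum_gt0 sB extend_enumerates.
have [q [l [lt_l ->]]] := block_split z M0.
rewrite block_actE //; move: lt_l M0 extend_enumerates.1.
rewrite /extend; set u := undup _; rewrite size_allpairs => lt_l M0 uniq_e.
have lt_j : (l %/ size s < size u)%N by rewrite ltn_divLR.
have lt_i := ltn_pmod l N0; rewrite (divn_eq l (size s)).
move: (l %/ size s)%N (l %% size s)%N lt_j lt_i => j i lt_j lt_i.
have ai : a * nth 1 s i \in s by apply: (mulg_enum sA sE) => //; apply: mem_nth.
rewrite nth_cosets // mulgA -{1}(nth_index 1 ai) -nth_cosets ?index_mem //.
rewrite index_uniq // ?size_allpairs; last first.
  apply: (@leq_trans (j.+1 * size s)); last by rewrite leq_mul2r lt_j orbT.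
  by rewrite mulSn addnC ltn_add2r index_mem.
by rewrite !PoszD !PoszM !GRing.mulrA !GRing.addrA -!GRing.mulrDl block_actE.
Qed.
End Extend.

(** * Gluing the actions along a chain of finite subgroups *)

Lemma exists_enumeration (A : set L) : finite_set A -> exists s, enumerates s A.
Proof.
move=> /finite_seqP[s ->]; exists (undup s); split; first exact: undup_uniq.
by move=> x; rewrite mem_undup.
Qed.

Lemma periodic_action_of_chain (A : nat -> set L) :
  (forall n, subgroup (A n)) -> (forall n, finite_set (A n)) ->
  (forall n, (A n `<=` A n.+1)%classic) -> (forall a, exists n, A n a) ->
  exists act : L -> int -> int,
    [/\ act 1 =1 id,
        forall a b, act (a * b) =1 act a \o act b,
        forall a, exists N, (0 < N)%N /\ periodic N (act a) &
        forall a, act a 0%R = 0%R -> a = 1].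
Proof.
move=> sA fA A_incr A_cover.
have [r rE] := boolp.choice (fun n => exists_enumeration (fA n)).
(* Independently chosen enumerations need not be compatible, so each is rearranged into cosets of
   the preceding subgroup. *)
pose s := fix s n := if n is n'.+1 then extend (s n') (r n) else r 0%N.
have sE n : enumerates (s n) (A n).
  by elim: n => [|n IH]; [exact: rE | apply: (@extend_enumerates (A n))].
have A_mono m n : (m <= n)%N -> (A m `<=` A n)%classic.
  move=> /subnK <-; elim: (n - m)%N => // d IH x /IH; exact: A_incr.
have act_mono m n a : (m <= n)%N -> A m a -> block_act (s n) a =1 block_act (s m) a.
  move=> /subnK <- Aa; elim: (n - m)%N => // d IH z.
  rewrite addSn -IH; apply: (@block_act_extend (A (d + m)%N) (A (d + m).+1)) => //.
  exact/A_mono/Aa/leq_addl.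
(* Any level containing a will do, since by [act_mono] all of them give the same action. *)
have [lev levP] := boolp.choice A_cover.
have actE n a : A n a -> block_act (s n) a =1 block_act (s (lev a)) a.
  move=> Aa z; rewrite -(act_mono n (maxn n (lev a))) ?leq_maxl //.
  by rewrite (act_mono (lev a)) ?leq_maxr.
exists (fun a => block_act (s (lev a)) a); split.
- exact: (@block_act1 (A (lev 1))).
- move=> a b z; pose n := maxn (lev a) (lev b).
  have Aa : A n a by exact/A_mono/levP/leq_maxl.
  have Ab : A n b by exact/A_mono/levP/leq_maxr.
  rewrite -(actE n) /=; last exact: subgroupM.
  by rewrite (block_actM (sA n)) //= !(actE n).
- move=> a; exists (size (s (lev a))).
  by split; [exact: size_enum_gt0 | exact: (@block_act_periodic (A (lev a)))].
- by move=> a; apply: (@block_act_free (A (lev a))).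
Qed.

Lemma subgroup_generated (A : set L) : subgroup (generated A).
Proof.
split=> [H [[H1 _] _] //|x y Hx Hy H HA]; have [[_ HF] _] := HA.
by apply: HF; [exact: Hx | exact: Hy].
Qed.

Lemma countable_locally_finite_chain :
  countable [set: L]%classic -> locally_finite L ->
  exists A : nat -> set L,
    [/\ forall n, subgroup (A n), forall n, finite_set (A n),
        forall n, (A n `<=` A n.+1)%classic & forall a, exists n, A n a].
Proof.
move=> /countable_injP[g g_inj] Lfin.
(* As [g] is injective, each level has finitely many generators; the bound is strict, so a is a
   generator from level g a + 1 on. *)
exists (fun n => generated [set x | (g x < n)%N]%classic); split.
- by move=> n; exact: subgroup_generated.
- move=> n; apply: Lfin; first exact: subgroup_generated.
  exists [set x | (g x < n)%N]%classic => //.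
  apply: (@finite_preimage _ _ [set i | (i < n)%N]%classic); last exact: finite_II.
  by move=> x y _ _; apply: g_inj; rewrite inE.
- move=> n; apply: sub_smallest2r; first exact: subgroup_generated.
  by move=> x /=; apply: ltnW.
- by move=> a; exists (g a).+1; apply: sub_gen_smallest => /=.
Qed.
End EnumerationAction.

Theorem mainTheorem2 (L : groupType) (countableL : countable [set: L]%classic)
    (locally_finiteL : locally_finite L) (k : nat) (k_ge2 : (2 <= k)%N) :
  exists f : {multiplicative L -> commensurator (free_group 'I_k)}, injective f.
Proof.
have [A [sA fA A_incr A_cover]] :=
  countable_locally_finite_chain countableL locally_finiteL.
have [act [act1 actM actN act_free]] :=
  periodic_action_of_chain sA fA A_incr A_cover.
(* The generators 0 and 1 of ['I_k] serve as t and x. *)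
exact: (@commensurator_of_periodic_action _
  (Ordinal (ltnW k_ge2)) (Ordinal k_ge2) L act).
Qed.
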